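(* Let $R$ be a finite associative ring and let $x \in R$. (a) There is a positive integer $n$ such that $e_x = x^n$ is an idempotent. (b) The idempotent $e_x$ is uniquely determined by $x$: if $r, s$ are positive integers such that $x^r$ and $x^s$ are both idempotents, then $x^r = x^s$.
   Context: Rings are not assumed commutative. An element $e$ of a ring is an idempotent if $e^2 = e$. *)

(* Defs.v *)
From HB Require Import structures.
From mathcomp Require Import all_boot all_algebra.

Set Implicit Arguments.
Unset Strict Implicit.
Unset Printing Implicit Defensive.

Import GRing.Theory.
Local Open Scope ring_scope.

(* Associative rings that need be neither commutative nor unital. All ring
   structures of ssralg contain a 1, so they cannot be used here. *)
HB.mixin Record Zmodule_isRng R of GRing.Zmodule R := {
  rng_mul : R -> R -> R;
  rng_mulA : associative rng_mul;
  rng_mulDl : left_distributive rng_mul +%R;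
  rng_mulDr : right_distributive rng_mul +%R
}.

#[short(type="rngType")]
HB.structure Definition Rng := {R of GRing.Zmodule R & Zmodule_isRng R}.

#[short(type="finRngType")]
HB.structure Definition FinRng := {R of Rng R & Finite R}.

(* x ^ n for n > 0, by the same iteration as GRing.exp. There being no unit,
   the value at n = 0 is the default 0 and has no mathematical meaning. *)
Definition rng_exp (R : rngType) (x : R) (n : nat) : R :=
  iterop n (@rng_mul R) x 0.

Definition rng_idempotent (R : rngType) (e : R) : Prop := rng_exp e 2 = e.

(* Unital rings are instances; the alias avoids overlapping with other
   canonical structures. *)
Definition rng_of_ring (R : pzRingType) : Type := R.

HB.instance Definition _ (R : pzRingType) := GRing.Zmodule.on (rng_of_ring R).
HB.instance Definition _ (R : pzRingType) :=
  Zmodule_isRng.Build (rng_of_ring R)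
    (@mulrA R) (@mulrDl R) (@mulrDr R).
HB.instance Definition _ (R : finPzRingType) := Finite.on (rng_of_ring R).

Lemma rng_exp_ring (R : pzRingType) (x : R) (n : nat) :
  (0 < n)%N -> rng_exp (x : rng_of_ring R) n = x ^+ n.
Proof. by case: n => // n _; rewrite /rng_exp iteropS -(iteropS 1). Qed.

Lemma rng_idempotent_ring (R : pzRingType) (e : R) :
  rng_idempotent (e : rng_of_ring R) <-> e ^+ 2 = e.
Proof. by []. Qed.

(* Main.v *)
Require Import Defs.
From mathcomp Require Import all_boot all_algebra.

(** By pigeonhole the powers of x repeat, so they are eventually periodic, say
    with period d from exponent i on. At the multiple n = i * d of the period,
    which is at least i, the exponents n and 2 n give the same power. For
    uniqueness, an idempotent equals its positive powers, so
    x^r = (x^r)^s = (x^s)^r = x^s. *)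

Lemma rng_expSS (R : rngType) (x : R) (n : nat) :
  rng_exp x n.+2 = rng_mul x (rng_exp x n.+1).
Proof. by []. Qed.

(** Both exponents must be positive: [rng_exp x 0] is the default [0], not a unit. *)
Lemma rng_expD (R : rngType) (x : R) (m n : nat) :
  (0 < m)%N -> (0 < n)%N ->
  rng_exp x (m + n) = rng_mul (rng_exp x m) (rng_exp x n).
Proof.
case: m n => [//|m] [//|n] _ _; elim: m => [|m IHm] //.
by rewrite (rng_expSS _ x m) -rng_mulA -IHm.
Qed.

Lemma rng_expM (R : rngType) (x : R) (m n : nat) :
  (0 < m)%N -> (0 < n)%N -> rng_exp x (m * n) = rng_exp (rng_exp x m) n.
Proof.
move=> m_gt0; case: n => // n _; elim: n => [|n IHn]; first by rewrite muln1.
by rewrite mulnS rng_expD ?muln_gt0 ?m_gt0 // IHn.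
Qed.

Lemma rng_idempotent_exp (R : rngType) (e : R) (n : nat) :
  (0 < n)%N -> rng_idempotent e -> rng_exp e n = e.
Proof.
case: n => // n _ ide; elim: n => // n IHn.
by rewrite rng_expSS IHn; exact: ide.
Qed.

Lemma rng_exp_repeat (R : finRngType) (x : R) :
  exists i d : nat,
    [/\ (0 < i)%N, (0 < d)%N & rng_exp x (i + d) = rng_exp x i].
Proof.
(* One more index than [R] has elements; the shift keeps all exponents positive. *)
pose f (i : 'I_#|R|.+1) := rng_exp x i.+1.
have /injectivePn [i [j neq_ij eq_f]] : ~~ injectiveb f.
  by apply/injectiveP => /leq_card; rewrite card_ord ltnn.
wlog lt_ij : i j neq_ij eq_f / (i < j)%N.
  move=> IH; case: (ltngtP i j) => [lt_ij|lt_ji|/val_inj eq_ij].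
  - exact: (IH i j).
  - by apply: (IH j i) => //; rewrite eq_sym.
  - by rewrite eq_ij eqxx in neq_ij.
exists i.+1, (j - i)%N; split; rewrite ?subn_gt0 //.
by rewrite addSn subnKC ?(ltnW lt_ij) //; symmetry.
Qed.

Lemma rng_exp_periodic (R : rngType) (x : R) (i d : nat) :
  (0 < i)%N -> (0 < d)%N -> rng_exp x (i + d) = rng_exp x i ->
  forall m k : nat, (i <= m)%N -> rng_exp x (m + k * d) = rng_exp x m.
Proof.
move=> i_gt0 d_gt0 eq_id.
have period m : (i <= m)%N -> rng_exp x (m + d) = rng_exp x m.
  (* Multiply [eq_id] by the power of [x] with exponent [m - i]; exponent 0 is split off, having no
     unit to stand for it. *)
  move/subnK <-; case: (m - i)%N => [//|c].
  by rewrite -addnA (rng_expD _ x c.+1) ?addn_gt0 ?i_gt0 // eq_id -rng_expD.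
move=> m; elim=> [|k IHk] le_im; first by rewrite addn0.
by rewrite mulSn addnCA addnC period ?IHk // (leq_trans le_im) ?leq_addr.
Qed.

Theorem lemma1p2 (R : finRngType) (x : R) :
  (exists n : nat, (0 < n)%N /\ rng_idempotent (rng_exp x n)) /\
  (forall r s : nat, (0 < r)%N -> (0 < s)%N ->
     rng_idempotent (rng_exp x r) -> rng_idempotent (rng_exp x s) ->
     rng_exp x r = rng_exp x s).
Proof.
split.
  have [i [d [i_gt0 d_gt0 eq_id]]] := rng_exp_repeat R x.
  have n_gt0 : (0 < i * d)%N by rewrite muln_gt0 i_gt0.
  exists (i * d)%N; split=> //.
  rewrite /rng_idempotent -rng_expM // muln2 -addnn.
  (* The shift [i * d] consists of [i] periods, and the start [i * d] is at least [i] as [d] is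
     positive. *)
  by apply: (rng_exp_periodic R x i d) => //; rewrite leq_pmulr.
move=> r s r_gt0 s_gt0 idr ids.
by rewrite -(rng_idempotent_exp _ _ _ s_gt0 idr) -rng_expM // mulnC rng_expM //
  rng_idempotent_exp.
Qed.
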